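(* Let $R$ be a commutative ring with nonzero identity, $I$ an ideal of $R$, $M$ a finitely generated faithful multiplication $R$-module and $P$ a proper submodule of $M$ such that $I(P:M)=(IP:M)$. Then $P$ is an $I$-primary submodule of $M$ if and only if whenever $N$ and $K$ are submodules of $M$ such that $NK\subseteq P$ and $NK\nsubseteq IP$, we have either $N\subseteq P$ or $K\subseteq\sqrt{P}$.
   Context: Modules are unitary. An $R$-module $M$ is a multiplication module if every submodule $N$ of $M$ has the form $N=AM$ for some ideal $A$ of $R$; it is faithful if its annihilator is zero. If $N=A_1M$ and $K=A_2M$ are submodules of a multiplication module $M$ ($A_1,A_2$ ideals of $R$), their product is $NK=A_1A_2M$, which is independent of the choice of $A_1,A_2$. For a submodule $P$ of $M$, $(P:M)=\{r\in R : rM\subseteq P\}$. For an ideal $A$ of $R$, $\sqrt{A}=\{a\in R : a^n\in A \text{ for some positive integer } n\}$. For a proper submodule $P$ of a multiplication module $M$, $\sqrt{P}$ denotes the $M$-radical of $P$, i.e. the intersection of all prime submodules of $M$ containing $P$ (and $M$ if there are none), which equals $\sqrt{(P:M)}\,M$. A proper submodule $P$ of $M$ is called an $I$-primary submodule of $M$ if for all $r\in R$ and $m\in M$, $rm\in P\setminus IP$ implies $m\in P$ or $r\in\sqrt{(P:M)}$. *)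

(* Defs.v *)
From HB Require Import structures.
From mathcomp Require Import all_boot all_algebra.
From mathcomp Require Import boolp classical_sets.

Set Implicit Arguments.
Unset Strict Implicit.
Unset Printing Implicit Defensive.

Import GRing.Theory.

Local Open Scope classical_set_scope.
Local Open Scope ring_scope.

(* Ideals and submodules are Prop-valued sets, so that no decidability of
   membership is imposed on them. *)

Section Definitions.
Variable R : comNzRingType.

Definition submodule (M : lmodType R) (N : set M) : Prop :=
  [/\ N 0, forall x y, N x -> N y -> N (x + y)
    & forall (r : R) x, N x -> N (r *: x)].

Definition proper_submodule (M : lmodType R) (N : set M) : Prop :=
  submodule N /\ N <> setT.

Definition ideal (A : set R) : Prop := @submodule R^o A.

(* The product A N of an ideal and a submodule: all finite sums of products
   a *: m with a in A and m in N. *)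
Definition smul (M : lmodType R) (A : set R) (N : set M) : set M :=
  [set x | exists (n : nat) (a : 'I_n -> R) (m : 'I_n -> M),
    [/\ forall i, A (a i), forall i, N (m i)
      & x = \sum_(i < n) a i *: m i]].

Definition ideal_mul (A B : set R) : set R := @smul R^o A B.

Definition radical (A : set R) : set R :=
  [set a | exists2 n : nat, (0 < n)%N & A (a ^+ n)].

Variable M : lmodType R.

Definition annihilator : set R := [set r | forall m : M, r *: m = 0].

Definition faithful : Prop := annihilator = [set 0].

Definition finitely_generated : Prop :=
  exists (n : nat) (g : 'I_n -> M),
    forall x : M, exists c : 'I_n -> R, x = \sum_(i < n) c i *: g i.

Definition multiplication_module : Prop :=
  forall N : set M, submodule N ->
    exists2 A : set R, ideal A & N = smul A [set: M].

Definition colon (P : set M) : set R := [set r | forall m : M, P (r *: m)].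

(* The choice of presentations N = A1 M and K = A2 M is irrelevant, see
   submod_mulE below. *)
Definition submod_mul (N K : set M) : set M :=
  [set x | exists A1 A2 : set R,
    [/\ ideal A1, ideal A2, N = smul A1 [set: M], K = smul A2 [set: M]
      & smul (ideal_mul A1 A2) [set: M] x]].

Definition prime_submodule (Q : set M) : Prop :=
  proper_submodule Q /\
  forall (r : R) (m : M), Q (r *: m) -> Q m \/ colon Q r.

(* The intersection is all of M when no prime submodule contains P. *)
Definition module_radical (P : set M) : set M :=
  \bigcap_(Q in [set Q | prime_submodule Q /\ P `<=` Q]) Q.

Definition I_primary (I : set R) (P : set M) : Prop :=
  proper_submodule P /\
  forall (r : R) (m : M),
    (P `\` smul I P) (r *: m) -> P m \/ radical (colon P) r.

End Definitions.

Arguments annihilator {R} M.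
Arguments faithful {R} M.
Arguments finitely_generated {R} M.
Arguments multiplication_module {R} M.

Lemma smul_gen (R : comNzRingType) (M : lmodType R) (A : set R) (N : set M) a m :
  A a -> N m -> smul A N (a *: m).
Proof.
move=> Aa Nm; exists 1%N, (fun=> a), (fun=> m); split=> //.
by rewrite big_ord1.
Qed.

Section SubmodMul.
Variables (R : comNzRingType) (M : lmodType R).

Lemma smul_submodule (A : set R) (N : set M) :
  submodule N -> submodule (smul A N).
Proof.
case=> N0 ND NZ; split.
- by exists 0%N, (fun=> 0), (fun=> 0); split; rewrite ?big_ord0 // => -[].
- move=> _ _ [n [a [m [Aa Nm ->]]]] [k [b [l [Ab Nl ->]]]].
  exists (n + k)%N, (fun i => match split i with inl j => a j | inr j => b j end),
    (fun i => match split i with inl j => m j | inr j => l j end).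
  split; [by move=> i; case: split | by move=> i; case: split |].
  rewrite big_split_ord /=; congr (_ + _); apply: eq_bigr => i _.
    by have -> : split (lshift k i) = inl i by exact: (unsplitK (inl i)).
  by have -> : split (rshift n i) = inr i by exact: (unsplitK (inr i)).
- move=> r _ [n [a [m [Aa Nm ->]]]].
  exists n, a, (fun i => r *: m i); split=> //; first by move=> i; exact: NZ.
  by rewrite scaler_sumr; apply: eq_bigr => i _; rewrite !scalerA mulrC.
Qed.

Lemma smul_min (A : set R) (N L : set M) : submodule L ->
  (forall a m, A a -> N m -> L (a *: m)) -> smul A N `<=` L.
Proof.
move=> [L0 LD _] h _ [n [a [m [Aa Nm ->]]]].
by elim/big_ind: _ => // i _; exact: h.
Qed.

Lemma submoduleT : submodule [set: M].
Proof. by []. Qed.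

Lemma smul_ideal_mul (A B : set R) :
  smul (ideal_mul A B) [set: M] = smul A (smul B [set: M]).
Proof.
have sB := smul_submodule B submoduleT.
apply/seteqP; split; apply: smul_min; try exact: smul_submodule.
  move=> _ m [n [a [b [Aa Bb ->]]]] _.
  rewrite scaler_suml; have [S0 SD _] := smul_submodule A sB.
  elim/big_ind: _ => // i _; rewrite -scalerA.
  by apply: smul_gen => //; exact: smul_gen.
move=> a _ Aa [n [b [m [Bb _ ->]]]]; rewrite scaler_sumr.
have [S0 SD _] := smul_submodule (ideal_mul A B) submoduleT.
elim/big_ind: _ => // i _; rewrite scalerA; apply: smul_gen => //.
exact: (@smul_gen R R^o).
Qed.

Lemma ideal_mulC (A B : set R) : ideal_mul A B = ideal_mul B A.
Proof.
by apply/seteqP; split=> _ [n [a [b [Aa Bb ->]]]]; exists n, b, a; split=> //;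
  apply: eq_bigr => i _; exact: mulrC.
Qed.

Lemma submod_mulE (A1 A2 : set R) : ideal A1 -> ideal A2 ->
  submod_mul (smul A1 [set: M]) (smul A2 [set: M]) =
  smul (ideal_mul A1 A2) [set: M].
Proof.
move=> iA1 iA2; apply/seteqP; split=> [x|x h]; last by exists A1, A2.
case=> B1 [B2 [_ _ e1 e2]].
by rewrite smul_ideal_mul -e2 -smul_ideal_mul ideal_mulC smul_ideal_mul -e1
  -smul_ideal_mul ideal_mulC.
Qed.

End SubmodMul.

(* Main.v *)
Require Import Defs.
From mathcomp Require Import all_boot all_algebra.
From mathcomp Require Import boolp classical_sets.

(** Write [K = B M], so that [N K = B N].  If [P] is [I]-primary, then for [b]
    in [B] and [n] in [N] either [b n] lies in [I P], or [n] lies in [P], or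
    [b M] lies in the radical of [P]; since a group is not the union of two
    proper subgroups, one of the three alternatives holds uniformly.

    Conversely, apply the product condition to [R m] and [r M].  It remains to
    see that [r M] contained in the radical of [P] forces [r ^ n M] into [P]
    for some [n].  Otherwise, as [M] is finitely generated, Zorn's lemma gives
    a submodule [Q] containing [P] and maximal among those containing no
    [r ^ n M].  Such a [Q] is prime: if [s m] is in [Q] with [m] outside [Q] and
    [s M] not in [Q], then [r ^ a M] lies in [Q + R m] and [r ^ b M] in
    [Q + s M], and writing [R m = A M] gives
    [r ^ b A M <= A Q + s A M = A Q + R s m <= Q], whence [r ^ (a + b) M <= Q]. *)

Local Open Scope classical_set_scope.
Local Open Scope ring_scope.

Set Implicit Arguments.

Import GRing.Theory.

(* [Zorn_bigcup] also asks for the union of the empty chain; this variant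
   starts from a given member instead. *)
Lemma Zorn_bigcup_above (T : Type) (G : set (set T)) (P : set T) :
  G P ->
  (forall F : set (set T), F !=set0 -> total_on F subset -> F `<=` G ->
     G (\bigcup_(X in F) X)) ->
  exists Q, [/\ G Q, P `<=` Q & forall X, Q `<` X -> ~ G X].
Proof.
move=> GP Gchain.
have [F FG Ftot|A [GA maxA]] := @Zorn_bigcup T [set X | G (P `|` X)].
  (* Adding [set0] puts [P] itself into the family, which is thus a nonempty chain even when [F] is
     empty. *)
  pose F' := [set P `|` X | X in set0 |` F].
  rewrite /=; have -> : P `|` \bigcup_(X in F) X = \bigcup_(X in F') X.
    apply/seteqP; split=> [x [Px|[X FX Xx]]|x [_ [X [->|FX] <-]]].
    - by exists (P `|` set0); [exists set0 => //; left | left].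
    - by exists (P `|` X); [exists X => //; right | right].
    - by case=> // Px; left.
    - by case=> [Px|Xx]; [left | right; exists X].
  apply: Gchain.
  - by exists (P `|` set0), set0 => //; left.
  - move=> _ _ [X FX <-] [Y FY <-].
    suff [XY|YX] : X `<=` Y \/ Y `<=` X by [left; exact: setUS | right; exact: setUS].
    by case: FX FY => [->|FX] [->|FY]; [left| left| right| exact: Ftot].
  - by move=> _ [X [->|FX] <-]; [rewrite setU0 | exact: FG].
exists (P `|` A); split=> // X [sX nX] GX.
have PX : P `<=` X by move=> x Px; apply: sX; left.
apply: (maxA X) => /=; last by rewrite (iffRL (setUidPr _ _) PX).
split=> [x Ax|XA]; first by apply: sX; right.
by apply: nX => x /XA Ax; right.
Qed.

Lemma bigcup_chain_finite (T : Type) (F : set (set T)) (n : nat) (x : 'I_n -> T) :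
  F !=set0 -> total_on F subset ->
  (forall i, (\bigcup_(X in F) X) (x i)) ->
  exists2 X, F X & forall i, X (x i).
Proof.
move=> F0 Ftot; elim: n x => [|n IHn] x Fx.
  by case: F0 => X FX; exists X => // -[].
have [X FX Xx] := IHn (fun i => x (lift ord0 i)) (fun i => Fx _).
have [Y FY Yx] := Fx ord0.
have [XY|YX] := Ftot _ _ FX FY; [exists Y | exists X] => // i;
  by have [->|[j ->]] : i = ord0 \/ exists j, i = lift ord0 j;
    [case: (unliftP ord0 i) => [j|] ->; [right; exists j | left] | auto..].
Qed.

Section Submodules.
Variables (R : comNzRingType) (M : lmodType R).
Implicit Types (N K L P Q C : set M) (A B : set R).

Lemma submodule_sub N x y : submodule N -> N x -> N y -> N (x - y).
Proof. by case=> _ ND NZ Nx Ny; rewrite -scaleN1r; apply/ND/NZ. Qed.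

Lemma submodule_sum N n (x : 'I_n -> M) :
  submodule N -> (forall i, N (x i)) -> N (\sum_(i < n) x i).
Proof. by case=> N0 ND _ Nx; elim/big_ind: _. Qed.

Lemma submodule_cyclic (m : M) : submodule [set r *: m | r in [set: R]].
Proof.
split; first by exists 0 => //; rewrite scale0r.
- by move=> _ _ [r _ <-] [s _ <-]; exists (r + s) => //; rewrite scalerDl.
- by move=> r _ [s _ <-]; exists (r * s) => //; rewrite scalerA.
Qed.

Lemma submodule_scale (r : R) : submodule [set r *: m | m in [set: M]].
Proof.
split; first by exists 0 => //; rewrite scaler0.
- by move=> _ _ [x _ <-] [y _ <-]; exists (x + y) => //; rewrite scalerDr.
- by move=> s _ [x _ <-]; exists (s *: x) => //; rewrite !scalerA mulrC.
Qed.

Lemma submodule_add N K : submodule N -> submodule K ->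
  submodule [set x + y | x in N & y in K].
Proof.
move=> [N0 ND NZ] [K0 KD KZ]; split.
- by exists 0 => //; exists 0 => //; rewrite addr0.
- move=> _ _ [x Nx [y Ky <-]] [x' Nx' [y' Ky' <-]].
  by exists (x + x'); [exact: ND | exists (y + y'); [exact: KD | rewrite addrACA]].
- move=> r _ [x Nx [y Ky <-]].
  by exists (r *: x); [exact: NZ | exists (r *: y); [exact: KZ | rewrite scalerDr]].
Qed.

Lemma submodule_bigcup_chain (F : set (set M)) :
  F !=set0 -> total_on F subset -> (forall X, F X -> submodule X) ->
  submodule (\bigcup_(X in F) X).
Proof.
move=> [X0 FX0] Ftot sF; split.
- by exists X0 => //; case: (sF _ FX0).
- move=> x y [X FX Xx] [Y FY Yy].
  have [XY|YX] := Ftot _ _ FX FY.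
    by exists Y => //; have [_ YD _] := sF _ FY; apply: YD => //; exact: XY.
  by exists X => //; have [_ XD _] := sF _ FX; apply: XD => //; exact: YX.
- by move=> r x [X FX Xx]; exists X => //; have [_ _ XZ] := sF _ FX; exact: XZ.
Qed.

Lemma submodule_module_radical P : submodule (module_radical P).
Proof.
split.
- by move=> Q [[[[Q0 _ _] _] _] _].
- move=> x y Px Py Q hQ; have [[[[_ QD _] _] _] _] := hQ.
  by apply: QD; [exact: Px | exact: Py].
- move=> r x Px Q hQ; have [[[[_ _ QZ] _] _] _] := hQ.
  by apply: QZ; exact: Px.
Qed.

(** Writing [N = A M] gives [N (B M) = (A B) M = B (A M)]. *)
Lemma submod_mul_smul N B : multiplication_module M -> submodule N -> ideal B ->
  submod_mul N (smul B [set: M]) = smul B N.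
Proof.
move=> hmul sN iB; have [A iA ->] := hmul N sN.
by rewrite submod_mulE // ideal_mulC smul_ideal_mul.
Qed.

(** If a prime [Q] above [P] contains [b ^ n M], primality strips off one factor [b] at a time. *)
Lemma radical_colon_sub P : radical (colon P) `<=` colon (module_radical P).
Proof.
move=> b [n _ bnP] m Q [[_ Qprime] PQ]; apply: contrapT => nQbm.
have: colon Q (b ^+ n) by move=> m'; exact/PQ/bnP.
elim: n {bnP} => [|n IHn] bnQ.
  by apply: nQbm; have := bnQ (b *: m); rewrite expr0 scale1r.
apply: IHn => m'; have := bnQ m'; rewrite exprS -scalerA.
by case/Qprime => // bQ; case: nQbm; exact: bQ.
Qed.

(** The two-subgroup argument runs twice: for [b] outside [colon C], [N] is covered by [P] and the
    [n] with [b n] in [L]; then [B] is covered by [colon C] and the [b] with [b N] inside [L]. *)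
Lemma scale_covering B N L P C :
  ideal B -> submodule N -> submodule L -> submodule P -> submodule C ->
  (forall b n, B b -> N n -> [\/ L (b *: n), P n | colon C b]) ->
  [\/ smul B N `<=` L, N `<=` P | B `<=` colon C].
Proof.
move=> [_ BD _] [_ ND _] sL sP sC cover.
have [BC|/existsNP[b0 /not_implyP[Bb0 nCb0]]] := pselect (B `<=` colon C).
  by constructor 3.
have [NP|/existsNP[n0 /not_implyP[Nn0 nPn0]]] := pselect (N `<=` P).
  by constructor 2.
have Ln0 b : B b -> ~ colon C b -> forall n, N n -> L (b *: n).
  move=> Bb nCb.
  have Ln n : N n -> ~ P n -> L (b *: n) by move=> Nn nPn; have [] := cover b n Bb Nn.
  move=> n Nn; have [Pn|/Ln] := pselect (P n); last exact.
  (* Here [n] is the difference of [n + n0] and [n0], both outside [P]. *)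
  rewrite -(addrK n0 n) scalerBr; apply: submodule_sub => //; apply: Ln => //.
    exact: ND.
  move=> Pnn0; apply: nPn0; rewrite -(addKr n n0) addrC.
  exact: submodule_sub.
constructor 1; apply: smul_min => // b n Bb Nn.
have [Cb|/Ln0] := pselect (colon C b); last exact.
rewrite -(addrK b0 b) scalerBl; apply: submodule_sub => //; apply: Ln0 => //.
  exact: BD.
move=> Cbb0; apply: nCb0 => m; rewrite -(addKr b b0) addrC scalerBl.
exact: submodule_sub.
Qed.

(** The finitely many [r g i] already lie in one member of the chain, and they generate [r M]. *)
Lemma colon_exp_bigcup_chain (F : set (set M)) (r : R) :
  finitely_generated M -> F !=set0 -> total_on F subset ->
  (forall X, F X -> submodule X) ->
  colon (\bigcup_(X in F) X) r -> exists2 X, F X & colon X r.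
Proof.
move=> [n [g gen]] F0 Ftot sF rF.
have [X FX Xg] :=
  bigcup_chain_finite (fun i => r *: g i) F0 Ftot (fun i => rF (g i)).
exists X => // m; have [c ->] := gen m; rewrite scaler_sumr.
apply: submodule_sum => [|i]; first exact: sF.
by rewrite scalerA mulrC -scalerA; have [_ _ XZ] := sF X FX; exact: XZ.
Qed.

Lemma maximal_avoiding_prime Q (r : R) : multiplication_module M ->
  submodule Q -> (forall n, ~ colon Q (r ^+ n)) ->
  (forall X, submodule X -> Q `<` X -> exists n, colon X (r ^+ n)) ->
  prime_submodule Q.
Proof.
move=> hmul sQ nrQ maxQ; have [Q0 QD QZ] := sQ.
split=> [|s m Qsm].
  by split=> // QT; apply: (nrQ 0%N) => m; rewrite QT.
have [Qm|nQm] := pselect (Q m); first by left.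
have [Qs|/existsNP[m1 nQsm1]] := pselect (colon Q s); first by right.
(* By maximality, enlarging [Q] by a [K] not inside it captures some [r ^ n M]. *)
have enlarge K x : submodule K -> K x -> ~ Q x ->
    exists n, colon [set x + y | x in Q & y in K] (r ^+ n).
  move=> sK Kx nQx; have [K0 _ _] := sK.
  apply: maxQ; first exact: submodule_add.
  split=> [y Qy|QKQ]; first by exists y => //; exists 0 => //; rewrite addr0.
  by apply/nQx/QKQ; exists 0 => //; exists x => //; rewrite add0r.
pose Rm := [set t *: m | t in [set: R]].
pose sM := [set s *: x | x in [set: M]].
have sRm : submodule Rm := submodule_cyclic m.
have [a ra] : exists n, colon [set x + y | x in Q & y in Rm] (r ^+ n).
  by apply: (enlarge _ m) => //; exists 1 => //; rewrite scale1r.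
have [b rb] : exists n, colon [set x + y | x in Q & y in sM] (r ^+ n).
  by apply: (enlarge _ _ (submodule_scale s) _ nQsm1); exists m1.
have [A iA RmE] := hmul _ sRm.
exfalso; apply: (nrQ (b + a)%N) => x; rewrite exprD -scalerA.
have [q Qq [_ [t _ <-] <-]] := ra x.
rewrite scalerDr; apply: (QD); first exact: (QZ).
have : smul A [set: M] (t *: m) by rewrite -RmE; exists t.
case=> k [c [y [Ac _ ->]]]; rewrite scaler_sumr.
apply: submodule_sum => // i; rewrite scalerA mulrC -scalerA.
have [q' Qq' [_ [z _ <-] <-]] := rb (y i).
rewrite scalerDr; apply: (QD); first exact: (QZ).
(* As [c i z] lies in [A M = R m], it equals some [u m], and [s (u m) = u (s m)] is in [Q]. *)
have : Rm (c i *: z) by rewrite RmE; exact: smul_gen.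
rewrite scalerA mulrC -scalerA => -[u _ <-].
by rewrite scalerA mulrC -scalerA; exact: QZ.
Qed.

Lemma colon_module_radical_sub P : finitely_generated M ->
  multiplication_module M -> submodule P ->
  colon (module_radical P) `<=` radical (colon P).
Proof.
move=> hfg hmul sP r rP; apply: contrapT => nrP.
pose G := [set X : set M | submodule X /\ forall n, ~ colon X (r ^+ n)].
have [|F F0 Ftot FG|Q [[sQ nrQ] PQ maxQ]] := @Zorn_bigcup_above M G P.
(* The radical asks for a positive exponent while [G] also excludes exponent 0, hence the passage
   from [n] to [n.+1]. *)
- split=> // n rnP; apply: nrP; exists n.+1 => // m.
  by rewrite exprSr -scalerA; exact: rnP.
- have sF X : F X -> submodule X by case/FG.
  split=> [|n rnF]; first exact: submodule_bigcup_chain.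
  have [X FX rnX] := colon_exp_bigcup_chain hfg F0 Ftot sF rnF.
  by have [_ /(_ n)] := FG _ FX.
(* Once [Q] is prime, the radical of [P] lies in [Q], so [r M] does too, against exponent 1. *)
apply: (nrQ 1%N); rewrite expr1 => m; apply: rP; split=> //.
apply: (@maximal_avoiding_prime Q r) => // X sX QX.
apply: contrapT => /forallNP nrX; exact: (maxQ X QX).
Qed.

End Submodules.

Theorem theorem2p13 (R : comNzRingType) (I : set R) (hI : ideal I)
    (M : lmodType R) (hfg : finitely_generated M) (hfaith : faithful M)
    (hmul : multiplication_module M)
    (P : set M) (hP : proper_submodule P)
    (hIP : ideal_mul I (colon P) = colon (smul I P)) :
  I_primary I P <->
  (forall N K : set M, submodule N -> submodule K ->
     submod_mul N K `<=` P -> ~ (submod_mul N K `<=` smul I P) ->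
     N `<=` P \/ K `<=` module_radical P).
Proof.
have [sP _] := hP; have sIP := smul_submodule I sP.
have sRad := submodule_module_radical M P.
split=> [[_ primP] N K sN sK|prodP].
  have [B iB ->] := hmul K sK; rewrite submod_mul_smul // => BNP nBNIP.
  (* With [L] equal to [I P], the first alternative contradicts the assumption on [N K]. *)
  have [|/nBNIP []|NP|BRad] := scale_covering (C := module_radical P) iB sN sIP sP sRad.
  - move=> b n Bb Nn.
    have [IPbn|nIPbn] := pselect (smul I P (b *: n)); first by constructor 1.
    have [|Pn|/radical_colon_sub] := primP b n; last by constructor 3.
      by split=> //; apply: BNP; exact: smul_gen.
    by constructor 2.
  - by left.
  - by right; apply: smul_min => // b m /BRad + _; exact.
split=> // r m [Prm nIPrm].
pose N := [set t *: m | t in [set: R]]; pose K := [set r *: x | x in [set: M]].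
have sN : submodule N := submodule_cyclic M m.
have sK : submodule K := submodule_scale M r.
have Nm : N m by exists 1 => //; rewrite scale1r.
have [A iA NE] := hmul N sN; have [B iB KE] := hmul K sK.
have NKE : submod_mul N K = smul A K.
  by rewrite NE KE submod_mulE // smul_ideal_mul.
have [||NP|KRad] := prodP N K sN sK.
- rewrite NKE; apply: smul_min => // a _ Aa [x _ <-].
  (* As [a x] lies in [A M = R m], the element [a (r x)] is a multiple of [r m], which is in [P]. *)
  have : N (a *: x) by rewrite NE; exact: smul_gen.
  rewrite scalerA mulrC -scalerA => -[t _ <-].
  by rewrite scalerA mulrC -scalerA; have [_ _] := sP; exact.
- rewrite NKE => /(_ (r *: m)) NKIP; apply/nIPrm/NKIP.
  (* Expanding [m] in [A M] puts [r m] in [A K = N K]. *)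
  have : smul A [set: M] m by rewrite -NE.
  case=> k [a [x [Aa _ ->]]]; rewrite scaler_sumr.
  apply: submodule_sum => [|i]; first exact: smul_submodule.
  by rewrite scalerA mulrC -scalerA; apply: smul_gen => //; exists (x i).
- by left; exact: NP.
- by right; apply: colon_module_radical_sub => // x; apply: KRad; exists x.
Qed.
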